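(* Let $\boldsymbol{x}_{\rm s},\boldsymbol{x}_{\rm d}\in\mathbb{R}^2$, let $\boldsymbol{w}=\frac{\boldsymbol{x}_{\rm s}+\boldsymbol{x}_{\rm d}}{2}$, $d=\|\boldsymbol{x}_{\rm s}-\boldsymbol{w}\|=\|\boldsymbol{x}_{\rm d}-\boldsymbol{w}\|$, and $\widehat{s}(\boldsymbol{x})=\max\{\|\boldsymbol{x}_{\rm s}-\boldsymbol{x}\|,\|\boldsymbol{x}-\boldsymbol{x}_{\rm d}\|\}$. Let $$\mathcal{H}=\left\{\boldsymbol{x}\in\mathbb{R}^2:(\boldsymbol{x}_{\rm s}-\boldsymbol{x}_{\rm d})^\top\boldsymbol{x}=\tfrac12\left(\|\boldsymbol{x}_{\rm s}\|^2-\|\boldsymbol{x}_{\rm d}\|^2\right)\right\}$$ be the equidistant hyperplane between $\boldsymbol{x}_{\rm s}$ and $\boldsymbol{x}_{\rm d}$. For a given $\boldsymbol{y}\in\mathbb{R}^2$, let $\mathcal{C}=\{\boldsymbol{x}\in\mathbb{R}^2:\|\boldsymbol{x}-\boldsymbol{w}\|=\|\boldsymbol{y}-\boldsymbol{w}\|\}$ be the circle around $\boldsymbol{w}$ with radius $\|\boldsymbol{y}-\boldsymbol{w}\|$. Then, for any $\boldsymbol{x}\in\mathcal{H}\cap\mathcal{C}$, we have $\widehat{s}(\boldsymbol{x})=\sqrt{d^2+\|\boldsymbol{y}-\boldsymbol{w}\|^2}$ and $\widehat{s}(\boldsymbol{x})\le\widehat{s}(\boldsymbol{y})$.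
   Context: $\|\cdot\|$ is the Euclidean norm on $\mathbb{R}^2$. *)

(* Defs.v *)
From mathcomp Require Import all_boot all_order all_algebra.
From mathcomp Require Import all_classical all_reals.
Set Implicit Arguments.
Unset Strict Implicit.
Unset Printing Implicit Defensive.

Import Order.TTheory GRing.Theory Num.Theory.
Local Open Scope classical_set_scope.
Local Open Scope ring_scope.

(* The norm `|v| of MathComp-Analysis on matrices is the
   sup norm, hence this separate definition of the Euclidean norm. *)
Definition enorm (R : realType) (n : nat) (v : 'cV[R]_n) : R :=
  Num.sqrt (\sum_(i < n) v i 0 ^+ 2).

Definition dotp (R : realType) (n : nat) (u v : 'cV[R]_n) : R :=
  (u^T *m v) 0 0.

Definition midpoint (R : realType) (xs xd : 'cV[R]_2) : 'cV[R]_2 :=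
  2^-1 *: (xs + xd).

Definition halfdist (R : realType) (xs xd : 'cV[R]_2) : R :=
  enorm (xs - midpoint xs xd).

Lemma halfdistE (R : realType) (xs xd : 'cV[R]_2) :
  halfdist xs xd = enorm (xd - midpoint xs xd).
Proof.
rewrite /halfdist /midpoint.
have -> : xs - 2^-1 *: (xs + xd) = - (xd - 2^-1 *: (xs + xd)).
  apply/eqP; rewrite -subr_eq0 opprK addrACA -opprD -scalerDl.
  by rewrite -div1r -splitr scale1r subrr.
by congr Num.sqrt; apply: eq_bigr => i _; rewrite [in LHS]mxE sqrrN.
Qed.

Definition shat (R : realType) (xs xd x : 'cV[R]_2) : R :=
  Num.max (enorm (xs - x)) (enorm (x - xd)).

(* When xs = xd this is the whole plane. *)
Definition equidistant (R : realType) (xs xd : 'cV[R]_2) : set 'cV[R]_2 :=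
  [set x | dotp (xs - xd) x = 2^-1 * (enorm xs ^+ 2 - enorm xd ^+ 2)].

Definition circle (R : realType) (w y : 'cV[R]_2) : set 'cV[R]_2 :=
  [set x | enorm (x - w) = enorm (y - w)].

(* Main.v *)
(* The median identity says that the mean of |xs - z|^2 and |z - xd|^2 is
   d^2 + |z - w|^2, which is constant on the circle. The squared maximum
   dominates this mean, with equality on the equidistant hyperplane. *)
Require Import Defs.
From mathcomp Require Import all_boot all_order all_algebra.
From mathcomp Require Import all_classical all_reals.
From mathcomp Require Import ring lra.
Import Order.TTheory GRing.Theory Num.Theory.
Local Open Scope classical_set_scope.
Local Open Scope ring_scope.

Lemma enorm_ge0 {R : realType} {n : nat} (v : 'cV[R]_n) : 0 <= enorm v.
Proof. exact: sqrtr_ge0. Qed.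

Lemma sqr_enorm {R : realType} {n : nat} (v : 'cV[R]_n) :
  enorm v ^+ 2 = \sum_(i < n) v i 0 ^+ 2.
Proof. by rewrite sqr_sqrtr // sumr_ge0 // => i _; exact: sqr_ge0. Qed.

(** Squared norms split over coordinates, and in each coordinate this is a polynomial identity. *)
Lemma median_identity {R : realType} (xs xd z : 'cV[R]_2) :
  enorm (xs - z) ^+ 2 + enorm (z - xd) ^+ 2 =
  2 * (halfdist xs xd ^+ 2 + enorm (z - midpoint xs xd) ^+ 2).
Proof.
rewrite /halfdist /midpoint !sqr_enorm -!big_split mulr_sumr /=.
by apply: eq_bigr => i _; rewrite !mxE; field.
Qed.

(** In the difference of the two squared distances the terms quadratic in [x] cancel; what remains
    is linear in [x] and vanishes by the hyperplane equation. *)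
Lemma equidistant_enorm {R : realType} {xs xd x : 'cV[R]_2} :
  equidistant xs xd x -> enorm (xs - x) = enorm (x - xd).
Proof.
rewrite /equidistant /= /dotp mxE !sqr_enorm !big_ord_recl !big_ord0 !mxE => Hx.
congr Num.sqrt; rewrite !big_ord_recl !big_ord0 !mxE.
lra.
Qed.

Lemma mean_sqr_le_max {R : realType} (a b : R) : 0 <= a -> 0 <= b ->
  a ^+ 2 + b ^+ 2 <= 2 * Num.max a b ^+ 2.
Proof.
move=> a0 b0; rewrite mulr_natl mulr2n.
by apply: lerD; rewrite ler_pXn2r ?nnegrE ?le_max ?a0 ?lexx ?orbT.
Qed.

Theorem lemma3 (R : realType) (xs xd y : 'cV[R]_2) :
  let w := midpoint xs xd in
  let d := halfdist xs xd in
  forall x : 'cV[R]_2, x \in equidistant xs xd `&` circle w y ->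
    shat xs xd x = Num.sqrt (d ^+ 2 + enorm (y - w) ^+ 2) /\
    shat xs xd x <= shat xs xd y.
Proof.
move=> w d x; rewrite inE => -[/equidistant_enorm Hx Cx].
have Sx : shat xs xd x = Num.sqrt (d ^+ 2 + enorm (y - w) ^+ 2).
  have := median_identity xs xd x.
  (* Both distances agree, so the median identity at [x] becomes an equation between doubled
     squares; cancel the 2. *)
  rewrite -/w -/d Cx /shat Hx maxxx -mulr2n -[LHS]mulr_natl.
  by move=> /(mulfI (lt0r_neq0 (ltr0Sn R 1))) <-; rewrite sqrtr_sqr ger0_norm ?enorm_ge0.
split=> //; rewrite Sx.
have Sy0 : 0 <= shat xs xd y by rewrite /shat le_max enorm_ge0.
(* Compare squares under the root, then double both sides to match the median identity at [y]. *)
rewrite -[leRHS](ger0_norm Sy0) -sqrtr_sqr ler_wsqrtr //.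
rewrite -(ler_pM2l (ltr0Sn R 1)) -median_identity.
by apply: mean_sqr_le_max; exact: enorm_ge0.
Qed.
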